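(* Let $n\geq 1$ and $k\geq 2$ be integers, and let $r$ be an integer with $1\le r\le$ the number of length-$n$ bordered words over $\Sigma_k$. The bordered word $w\in\Sigma_k^n$ with rank $r$ (i.e., the $r$-th word in the lexicographic listing of all length-$n$ bordered words over $\Sigma_k$) can be computed from $r,n,k$ in $O(n^4k\log k)$ time using $O(n)$ space, under the unit-cost RAM model.
   Context: $\Sigma_k=\{1,2,\ldots,k\}$ with $1<2<\cdots<k$, and $\Sigma_k^n$ is the set of length-$n$ words over $\Sigma_k$. Lexicographic order: for $x=x_1\cdots x_m$ and $y=y_1\cdots y_n$, $x<y$ if $x$ is a proper prefix of $y$, or if $x_i<y_i$ for the smallest $i$ with $x_i\neq y_i$. A border of a word $w$ is a word that is both a non-empty proper prefix and a non-empty proper suffix of $w$; $w$ is bordered if it has a border. Ranks start at $1$. Unit-cost RAM model: integer variables use constant space and integer arithmetic operations take constant time. *)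

(* Defs.v *)
From mathcomp Require Import all_boot.
Set Implicit Arguments. Unset Strict Implicit. Unset Printing Implicit Defensive.

(* A word of Sigma_k^n is represented by w : n.-tuple 'I_k ; letter a : 'I_k
   stands for the symbol (a + 1) of Sigma_k = {1,..,k}. *)
Definition wordval (n k : nat) (w : n.-tuple 'I_k) : seq nat :=
  map (fun a : 'I_k => (val a).+1) w.

Definition bordered (w : seq nat) : bool :=
  [exists m : 'I_(size w), (0 < m) && (take m w == drop (size w - m) w)].

Fixpoint lexlt (x y : seq nat) : bool :=
  match x, y with
  | [::], [::] => false
  | [::], _ :: _ => true
  | _ :: _, [::] => false
  | a :: x', b :: y' => (a < b) || ((a == b) && lexlt x' y')
  end.
Definition lexle (x y : seq nat) : bool := (x == y) || lexlt x y.

Definition num_bordered (n k : nat) : nat :=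
  #|[set w : n.-tuple 'I_k | bordered (wordval w)]|.

Definition bordered_rank (n k : nat) (w : n.-tuple 'I_k) : nat :=
  #|[set w' : n.-tuple 'I_k | bordered (wordval w') && lexle (wordval w') (wordval w)]|.

(* Registers R[0], R[1], ... hold natural numbers of unbounded size; each
   instruction costs one time unit. Subtraction is truncated, x / 0 = x mod 0
   conventions are those of ssrnat (x %/ 0 = 0, x %% 0 = x). *)
Inductive instr : Type :=
  | IConst of nat & nat            (* R[d] := c *)
  | IAdd of nat & nat & nat        (* R[d] := R[a] + R[b] *)
  | ISub of nat & nat & nat        (* R[d] := R[a] - R[b] (truncated) *)
  | IMul of nat & nat & nat        (* R[d] := R[a] * R[b] *)
  | IDiv of nat & nat & nat        (* R[d] := R[a] / R[b] *)
  | IMod of nat & nat & nat        (* R[d] := R[a] mod R[b] *)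
  | ILoad of nat & nat             (* R[d] := R[R[a]] *)
  | IStore of nat & nat            (* R[R[a]] := R[s] *)
  | IJz of nat & nat               (* if R[a] = 0 then goto l *)
  | IJmp of nat                    (* goto l *)
  | IHalt.

Definition program := seq instr.
Definition memory := nat -> nat.

Definition upd (m : memory) (d v : nat) : memory :=
  fun i => if i == d then v else m i.

Definition cur (p : program) (pc : nat) : instr := nth IHalt p pc.

(* a program halts when pc points at IHalt or outside the program *)
Definition halted (p : program) (pc : nat) : bool :=
  if cur p pc is IHalt then true else false.

Definition step (p : program) (pc : nat) (m : memory) : nat * memory :=
  match cur p pc with
  | IConst d c => (pc.+1, upd m d c)
  | IAdd d a b => (pc.+1, upd m d (m a + m b))
  | ISub d a b => (pc.+1, upd m d (m a - m b))
  | IMul d a b => (pc.+1, upd m d (m a * m b))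
  | IDiv d a b => (pc.+1, upd m d (m a %/ m b))
  | IMod d a b => (pc.+1, upd m d (m a %% m b))
  | ILoad d a => (pc.+1, upd m d (m (m a)))
  | IStore a s => (pc.+1, upd m (m a) (m s))
  | IJz a l => (if m a == 0 then l else pc.+1, m)
  | IJmp l => (l, m)
  | IHalt => (pc, m)
  end.

Definition accessed (p : program) (pc : nat) (m : memory) : seq nat :=
  match cur p pc with
  | IConst d _ => [:: d]
  | IAdd d a b | ISub d a b | IMul d a b | IDiv d a b | IMod d a b => [:: d; a; b]
  | ILoad d a => [:: d; a; m a]
  | IStore a s => [:: a; s; m a]
  | IJz a _ => [:: a]
  | IJmp _ | IHalt => [::]
  end.

Fixpoint run (p : program) (t pc : nat) (m : memory) : option memory :=
  if halted p pc then Some m else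
  match t with
  | 0 => None
  | t'.+1 => let: (pc', m') := step p pc m in run p t' pc' m'
  end.

Fixpoint space_ok (p : program) (t S pc : nat) (m : memory) : bool :=
  if halted p pc then true else
  match t with
  | 0 => true
  | t'.+1 => all (fun i => i < S) (accessed p pc m) &&
             (let: (pc', m') := step p pc m in space_ok p t' S pc' m')
  end.

Definition init_mem (r n k : nat) : memory :=
  fun i => if i == 0 then r else if i == 1 then n else if i == 2 then k else 0.

(* Main.v *)
Require Import Defs.
From mathcomp Require Import all_boot zify.
Set Implicit Arguments. Unset Strict Implicit. Unset Printing Implicit Defensive.

(* The word is built greedily from left to right: at each position the letters
   are tried in increasing order, and the number of bordered words starting with
   the current prefix is subtracted from the rank until the rank fits.

   These numbers are computed as follows. The shortest border of a bordered word
   of length b is unbordered and has length j <= b / 2, and it is the only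
   unbordered border. Hence the bordered words of length b agreeing with a prefix
   p are counted by summing over j the number U(j) of unbordered words of length
   j agreeing with p, times a product with one factor per position i from j to
   b - 1: k or 1 if i is beyond p, 1 or a comparison of two letters of p
   otherwise. In turn U(b) is the complement of this sum, so that one count takes
   O(n^3) operations and a table of n numbers; there are at most n k counts. *)

(** * Words and shortest borders *)

Fixpoint words (k n : nat) : seq (seq nat) :=
  if n is n'.+1 then [seq rcons x a | x <- words k n', a <- iota 1 k]
  else [:: [::]].

Lemma mem_words k n (x : seq nat) :
  (x \in words k n) = (size x == n) && all (fun a => 0 < a <= k) x.
Proof.
elim: n x => [|n IHn] x /=; first by rewrite inE; case: x.
apply/allpairsP/andP => [[[y a] /= [yw ka ->]]|[]].
  move: yw; rewrite IHn => /andP[/eqP <- ay]; rewrite size_rcons all_rcons ay.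
  by move: ka; rewrite mem_iota eqxx; split; lia.
case/lastP: x => // y a; rewrite size_rcons all_rcons eqSS => sy /andP[ka ay].
by exists (y, a); split; rewrite //= ?IHn ?sy ?ay // mem_iota; lia.
Qed.

Lemma words_size k n (x : seq nat) : x \in words k n -> size x = n.
Proof. by rewrite mem_words => /andP[/eqP]. Qed.

Lemma words_nth k n (x : seq nat) i : x \in words k n -> i < n -> 0 < nth 0 x i <= k.
Proof.
by rewrite mem_words => /andP[/eqP <- /allP ax] ix; apply/ax/mem_nth.
Qed.

Lemma words_uniq k n : uniq (words k n).
Proof.
elim: n => //= n IHn; apply: allpairs_uniq => //; first exact: iota_uniq.
by move=> [x a] [y b] _ _ /= /rcons_inj[-> ->].
Qed.

Lemma wordval_inj n k : injective (@wordval n k).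
Proof.
move=> u v /inj_map uv; apply/val_inj/uv => a b [ab]; exact: val_inj.
Qed.

Lemma words_wordval k n (x : seq nat) :
  x \in words k n -> exists w : n.-tuple 'I_k, wordval w = x.
Proof.
rewrite mem_words => /andP[/eqP sx ax].
case: k ax => [|k] ax.
  case: x sx ax => [|a x] sx /=; last by lia.
  by rewrite -sx => _; exists [tuple].
have sw : size [seq inord a.-1 : 'I_k.+1 | a <- x] == n by rewrite size_map sx.
exists (Tuple sw); rewrite /wordval /= -map_comp -[RHS]map_id.
apply/eq_in_map => a /(allP ax) /= ka; rewrite inordK; lia.
Qed.

Lemma wordval_words n k (w : n.-tuple 'I_k) : wordval w \in words k n.
Proof.
rewrite mem_words size_map size_tuple eqxx /=.
by apply/allP => _ /mapP[a _ ->]; rewrite ltnS leq0n ltn_ord.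
Qed.

Lemma card_words n k (P : pred (seq nat)) :
  #|[set w : n.-tuple 'I_k | P (wordval w)]| = count P (words k n).
Proof.
rewrite cardsE cardE size_filter -enumT -(count_map _ P).
apply/permP/uniq_perm.
- by rewrite map_inj_uniq ?enum_uniq //; apply: wordval_inj.
- exact: words_uniq.
move=> x; apply/mapP/idP => [[w _ ->]|/words_wordval[w <-]].
  exact: wordval_words.
by exists w; rewrite ?mem_enum.
Qed.

Lemma count_add (T : eqType) (P Q1 Q2 : pred T) (s : seq T) :
  (forall x, x \in s -> P x = Q1 x + Q2 x :> nat) ->
  count P s = count Q1 s + count Q2 s.
Proof.
elim: s => //= x s IHs PE; rewrite PE ?mem_head // addnACA -IHs // => y ys.
by apply: PE; rewrite inE ys orbT.
Qed.

(** If the letters allowed after an admissible word number [f] whatever the word, appending a letter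
    multiplies the count by [f]. Both product formulas below are instances. *)
Lemma count_words_rcons k n (P' P : pred (seq nat)) (q : seq nat -> pred nat) f :
  (forall x a, x \in words k n -> P' (rcons x a) = P x && q x a) ->
  (forall x, x \in words k n -> P x -> count (q x) (iota 1 k) = f) ->
  count P' (words k n.+1) = count P (words k n) * f.
Proof.
(* The trivial inclusion is generalised with the goal, so that the induction over a sublist still
   knows that its members are words. *)
move=> P'E qf /=; have: {subset words k n <= words k n} by [].
elim: {1 3 4}(words k n) => //= x s IHs sub.
have xw : x \in words k n by apply: sub; rewrite inE eqxx.
rewrite count_cat count_map IHs; last by move=> y ys; apply: sub; rewrite inE ys orbT.
rewrite mulnDl; congr (_ + _).
case Px: (P x); last first.
  rewrite mul0n (@eq_count _ _ pred0) ?count_pred0 // => a /=.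
  by rewrite P'E // Px.
by rewrite mul1n -(qf x) //; apply: eq_count => a /=; rewrite P'E // Px.
Qed.

Lemma count_iota1 k c (b : bool) :
  0 < c <= k -> count (fun a => b && (a == c)) (iota 1 k) = b.
Proof.
move=> ck; case: b; last by rewrite (eq_count (a2 := pred0)) ?count_pred0.
rewrite (@eq_count _ _ (pred1 c)) // (count_uniq_mem _ (iota_uniq _ _)).
by rewrite mem_iota; lia.
Qed.

Definition isborder (x : seq nat) (j : nat) : bool :=
  all (fun l => nth 0 x l == nth 0 x (l + (size x - j))) (iota 0 j).

Lemma isborderP x j :
  reflect (forall l, l < j -> nth 0 x l = nth 0 x (l + (size x - j)))
          (isborder x j).
Proof.
apply: (iffP allP) => [h l lj|h l]; first by apply/eqP/h; rewrite mem_iota.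
by rewrite mem_iota /= => lj; apply/eqP/h.
Qed.

Lemma isborderE (x : seq nat) j : j <= size x ->
  (take j x == drop (size x - j) x) = isborder x j.
Proof.
move=> jx; apply/eqP/isborderP => [e l lj|h].
  by rewrite -(nth_take 0 lj) e nth_drop addnC.
apply: (@eq_from_nth _ 0) => [|l]; rewrite size_take_min ?size_drop.
  lia.
move=> lj'; have lj : l < j by lia.
by rewrite nth_take // nth_drop h // addnC.
Qed.

Lemma borderedP x :
  reflect (exists j, [/\ 0 < j, j < size x & isborder x j]) (bordered x).
Proof.
apply: (iffP existsP) => [[[j jx] /= /andP[j0 jb]]|[j [j0 jx jb]]].
  by exists j; split => //; rewrite -isborderE // ltnW.
by exists (Ordinal jx); rewrite /= j0 isborderE // ltnW.
Qed.

(** The prefix of length [j] recurs at the end of [x], so both end with the same [i] letters. *)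
Lemma isborder_take (x : seq nat) i j : i < j <= size x -> isborder x j ->
  isborder (take j x) i = isborder x i.
Proof.
move=> ij /isborderP xj; apply/isborderP/isborderP => h l li.
  have lj : l < j by lia.
  rewrite -(nth_take 0 lj) h // size_take_min nth_take; last by lia.
  by rewrite xj; [congr nth; lia|lia].
rewrite size_take_min !nth_take; try lia.
by rewrite h // [RHS]xj; [congr nth; lia|lia].
Qed.

Definition shortest_border (x : seq nat) (j : nat) : bool :=
  ~~ bordered (take j x) && isborder x j.

(** At most one summand is 1: of two unbordered borders, the shorter would be a border of the
    longer. If [x] is bordered, its least border contributes 1. *)
Lemma bordered_sum x :
  bordered x = \sum_(1 <= j < (size x)./2.+1) shortest_border x j :> nat.
Proof.
have uniq_sb i j : 0 < i < j -> j <= (size x)./2 ->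
    shortest_border x i -> shortest_border x j -> False.
  move=> ij jx /andP[_ bi] /andP[/negP ubj bj]; apply: ubj.
  apply/borderedP; exists i; rewrite isborder_take //; last by lia.
  by rewrite size_take_min; split => //; lia.
case: borderedP => [ex|nb]; last first.
  rewrite big_nat_cond big1 // => j; rewrite andbT => jx.
  case: (boolP (shortest_border x j)) => // /andP[_ bj]; case: nb.
  by exists j; split => //; lia.
have exb : exists j, [&& 0 < j, j < size x & isborder x j].
  by case: ex => j [? ? ?]; exists j; apply/and3P.
case: (ex_minnP exb) => j /and3P[j0 jx bj] jmin.
have jh : j <= (size x)./2.
  (* overlapping occurrences of a border produce a shorter border *)
  rewrite leqNgt; apply/negP => jh; move/isborderP: bj => bj.
  suff: j <= j + j - size x by lia.
  apply: jmin; rewrite andbA; apply/andP; split; first by lia.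
  apply/isborderP => l lj; rewrite (bj l); last by lia.
  by rewrite (bj (l + _)); [congr nth; lia|lia].
(* A border of the least border would be a smaller border of [x]. *)
have sj : shortest_border x j.
  rewrite /shortest_border bj andbT; apply/negP => /borderedP[i []].
  rewrite size_take_min => i0 ij; rewrite isborder_take //; last by lia.
  move=> bi; suff: j <= i by lia.
  by apply: jmin; rewrite i0 bi andbT; lia.
have jr : j \in index_iota 1 (size x)./2.+1 by rewrite mem_index_iota; lia.
rewrite (bigD1_seq j jr) ?iota_uniq //=.
rewrite sj big_nat_cond big1 // => i /andP[ix ij].
case: (boolP (shortest_border x i)) => // si.
by case: (ltnP i j) => ij'; [case: (uniq_sb i j)|case: (uniq_sb j i)] => //; lia.
Qed.

(** * Counting the words that agree with a prefix *)

Section Counting.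

Variables (k m : nat) (p : nat -> nat).

(** The word may be shorter than the prefix: the border recursion needs counts for all lengths up to
    [n]. *)
Definition agree (x : seq nat) : bool :=
  all (fun i => (i < m) ==> (nth 0 x i == p i)) (iota 0 (size x)).

Lemma agreeP x :
  reflect (forall i, i < m -> i < size x -> nth 0 x i = p i) (agree x).
Proof.
apply: (iffP allP) => [h i im ix|h i].
  by have := h i; rewrite mem_iota im => /(_ ix)/eqP.
by rewrite mem_iota => ix; apply/implyP => im; apply/eqP/h.
Qed.

(** The test at position [i] reads no later position, so an appended letter leaves the earlier tests
    unchanged and adds one. *)
Lemma all_iota_nth_rcons (F : nat -> (nat -> nat) -> bool) (x : seq nat) a :
  (forall i f g, (forall j, j <= i -> f j = g j) -> F i f = F i g) ->
  all (F^~ (nth 0 (rcons x a))) (iota 0 (size (rcons x a))) =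
  all (F^~ (nth 0 x)) (iota 0 (size x)) && F (size x) (nth 0 (rcons x a)).
Proof.
move=> Fl; rewrite size_rcons -addn1 iotaD all_cat /= andbT add0n.
congr (_ && _); apply: eq_in_all => i; rewrite mem_iota => ix.
by apply: Fl => j ji; rewrite nth_rcons; case: ltnP => //; lia.
Qed.

Lemma agree_rcons x a :
  agree (rcons x a) = agree x && ((size x < m) ==> (a == p (size x))).
Proof.
rewrite /agree (@all_iota_nth_rcons (fun i f => (i < m) ==> (f i == p i))).
  by rewrite nth_rcons ltnn eqxx.
by move=> i f g ->.
Qed.

Definition num_agree n := count agree (words k n).
Definition num_agree_unbordered n :=
  count (fun x => agree x && ~~ bordered x) (words k n).
Definition num_agree_bordered n :=
  count (fun x => agree x && bordered x) (words k n).

(* The words agreeing with p whose unbordered prefix of length j reappears, as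
   far as the word reaches, at position d. *)
Definition echo d j (x : seq nat) : bool :=
  [&& ~~ bordered (take j x), agree x &
      all (fun l => (d <= l) ==> (nth 0 x l == nth 0 x (l - d)))
          (iota 0 (size x))].

Definition num_echo d j i := count (echo d j) (words k i).

Hypothesis p_letter : forall i, i < m -> 0 < p i <= k.

Lemma num_agree0 : num_agree 0 = 1.
Proof. by []. Qed.

Lemma num_agreeS n :
  num_agree n.+1 = num_agree n * (if n < m then 1 else k).
Proof.
apply: (count_words_rcons (q := fun _ a => (n < m) ==> (a == p n))).
  by move=> x a xw; rewrite agree_rcons (words_size xw).
move=> x xw _; case: ltnP => nm /=; first by rewrite (@count_iota1 k _ true) ?p_letter.
by rewrite count_predT size_iota.
Qed.

(** No position of a word of length [j] reaches [d], so the repetition condition is vacuous. *)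
Lemma num_echo_start d j : j <= d -> num_echo d j j = num_agree_unbordered j.
Proof.
move=> jd; apply: eq_in_count => x xw; rewrite /echo (words_size xw).
rewrite take_oversize ?(words_size xw) // andbC.
rewrite (_ : all _ _ = true) ?andbT //; apply/allP => l; rewrite mem_iota => lj.
by apply/implyP; lia.
Qed.

(** The letter at [i] may be forced by the prefix (if [i < m]) and by the letter [d] places earlier
    (if [d <= i]). Unforced it has [k] choices, forced once it has one, and forced twice it exists
    only if both demands agree. *)
Lemma num_echoS d j i : 0 < d -> j <= i ->
  num_echo d j i.+1 = num_echo d j i *
    (if i < m then (if i < d then 1 else p i == p (i - d))
     else (if i < d then k else 1)).
Proof.
move=> d0 ji.
apply: (count_words_rcons (q := fun x a =>
  ((i < m) ==> (a == p i)) && ((d <= i) ==> (a == nth 0 x (i - d))))).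
  move=> x a xw; rewrite /echo agree_rcons.
  rewrite (@all_iota_nth_rcons (fun l f => (d <= l) ==> (f l == f (l - d)))).
    rewrite (words_size xw) -cats1 takel_cat ?(words_size xw) //.
    rewrite !nth_cat (words_size xw) ltnn subnn /=.
    case: (leqP d i) => di /=; last by case: bordered; case: agree; rewrite ?andbT //= andbC.
    rewrite (_ : i - d < i); last by lia.
    by do !bool_congr; rewrite -!andbA; do !bool_congr.
  by move=> l f g fg; rewrite !fg //; lia.
move=> x xw /and3P[_ /agreeP xp _]; rewrite (words_size xw) in xp.
case: ltnP => im; case: ltnP => di /=.
- under eq_count do rewrite andbT.
  by rewrite (@count_iota1 k _ true) ?p_letter.
(* As [i - d < m], the letter to be repeated is itself a letter of the prefix. *)
- rewrite xp; [|lia..].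
  rewrite -(@count_iota1 k (p i)) ?p_letter //; apply: eq_count => a /=.
  by case: (a =P p i) => [->|_]; rewrite ?andbT ?andbF.
- by rewrite count_predT size_iota.
by rewrite (@count_iota1 k _ true) ?(words_nth xw) //; lia.
Qed.

(** Sum [bordered_sum] over all words and exchange the sums: a border of length [j] is an echo of
    the prefix at position [n - j]. *)
Lemma num_agree_bordered_sum n :
  num_agree_bordered n = \sum_(1 <= j < n./2.+1) num_echo (n - j) j n.
Proof.
rewrite /num_agree_bordered /num_echo -sum1_count big_mkcond /=.
under [RHS]eq_bigr do rewrite -sum1_count big_mkcond /=.
rewrite exchange_big /= big_seq_cond [RHS]big_seq_cond.
apply: eq_bigr => x; rewrite andbT => xw.
rewrite (_ : (if _ then _ else _) = agree x * bordered x); last by case: agree; case: bordered.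
rewrite bordered_sum big_distrr (words_size xw) /=; apply: eq_big_nat => j jn.
rewrite /echo /shortest_border.
suff -> : isborder x j = all (fun l => (n - j <= l) ==>
    (nth 0 x l == nth 0 x (l - (n - j)))) (iota 0 (size x)).
  by case: bordered; case: agree; case: all.
apply/isborderP/allP => [h l|h l lj].
  rewrite mem_iota (words_size xw) => ln; apply/implyP => jl; apply/eqP.
  rewrite (words_size xw) in h; rewrite [RHS]h; [congr nth; lia|lia].
have := h (l + (n - j)); rewrite mem_iota (words_size xw).
have ln : l + (n - j) < n by lia.
by rewrite leq_addl addnK => /(_ ln)/eqP <-.
Qed.

End Counting.

Lemma num_agree_unborderedE k m p n :
  num_agree_unbordered k m p n = num_agree k m p n - num_agree_bordered k m p n.
Proof.
have -> : num_agree k m p n = num_agree_bordered k m p n + num_agree_unbordered k m p n.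
  rewrite /num_agree /num_agree_bordered /num_agree_unbordered.
  by apply: count_add => x _; case: agree; case: bordered.
by rewrite addKn.
Qed.

(** * Lexicographic rank through prefixes *)

Lemma lexlt_irr x : lexlt x x = false.
Proof. by elim: x => //= a x ->; rewrite ltnn eqxx. Qed.

Lemma lexlt_rcons (x y : seq nat) a b : size x = size y ->
  lexlt (rcons x a) (rcons y b) = lexlt x y || ((x == y) && (a < b)).
Proof.
elim: x y => [|c x IHx] [|d y] //= => [_|[/IHx->]]; first by rewrite andbF orbF.
by rewrite eqseq_cons andb_orr andbA orbA.
Qed.

Section Rank.

Variables n k : nat.

(** Words starting with [s] are left out, so the bordered words starting with [s] have the ranks
    from [num_below s + 1] to [num_below s + num_prefix s]. *)
Definition num_below (s : seq nat) : nat :=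
  count (fun x => bordered x && lexlt (take (size s) x) s) (words k n).

Definition num_prefix (s : seq nat) : nat :=
  count (fun x => bordered x && (take (size s) x == s)) (words k n).

Lemma num_prefixE s : size s <= n ->
  num_prefix s = num_agree_bordered k (size s) (nth 0 s) n.
Proof.
move=> sn; apply: eq_in_count => x xw; rewrite andbC; congr (_ && _).
apply/eqP/agreeP => [e i si xi|h]; first by rewrite -[in RHS]e nth_take.
apply: (@eq_from_nth _ 0) => [|i]; rewrite size_take_min (words_size xw); first lia.
move=> lt_i; have i_s : i < size s by lia.
by rewrite nth_take // h // (words_size xw); lia.
Qed.

Lemma num_below_rcons1 s : size s < n -> num_below (rcons s 1) = num_below s.
Proof.
move=> sn; apply: eq_in_count => x xw; congr (_ && _).
rewrite size_rcons (take_nth 0) ?(words_size xw) // lexlt_rcons.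
  by have := words_nth xw sn; case: nth => [|c]; rewrite ?andbF ?orbF.
by rewrite size_take_min (words_size xw); lia.
Qed.

Lemma num_below_rconsS s a : size s < n ->
  num_below (rcons s a.+1) = num_below (rcons s a) + num_prefix (rcons s a).
Proof.
move=> sn; rewrite /num_below /num_prefix !size_rcons.
apply: count_add => x xw; case: bordered => //=.
rewrite (take_nth 0) ?(words_size xw) // eqseq_rcons.
have sE : size (take (size s) x) = size s.
  by rewrite size_take_min (words_size xw); lia.
rewrite !lexlt_rcons //; case: eqP => [->|_]; last by rewrite !orbF addn0.
by rewrite lexlt_irr /=; lia.
Qed.

(** The letter [k.+1] is a sentinel above the alphabet; it marks the end of the block of words
    starting with [s]. *)
Lemma num_below_rcons_last s : size s < n ->
  num_below (rcons s k.+1) = num_below s + num_prefix s.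
Proof.
move=> sn; rewrite /num_below /num_prefix !size_rcons.
apply: count_add => x xw; case: bordered => //=.
have sE : size (take (size s) x) = size s.
  by rewrite size_take_min (words_size xw); lia.
rewrite (take_nth 0) ?(words_size xw) // lexlt_rcons //.
have := words_nth xw sn; case: eqP => [->|_]; last by rewrite orbF addn0.
by rewrite lexlt_irr /=; lia.
Qed.

Lemma num_below_nil : num_below [::] = 0.
Proof.
rewrite /num_below (@eq_count _ _ pred0) ?count_pred0 // => x /=.
by rewrite take0 andbF.
Qed.

Lemma num_prefix_nil : num_prefix [::] = num_bordered n k.
Proof.
rewrite /num_bordered card_words; apply: eq_count => x.
by rewrite take0 eqxx andbT.
Qed.

Lemma num_prefix_word s : s \in words k n -> num_prefix s = bordered s.
Proof.
move=> sw; rewrite /num_prefix.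
rewrite (@eq_in_count _ _ (fun x => bordered s && (x == s))).
  case: bordered; last by rewrite (eq_count (a2 := pred0)) ?count_pred0.
  rewrite (@eq_count _ _ (pred1 s)) // (count_uniq_mem _ (words_uniq k n)).
  by rewrite sw.
move=> x xw; rewrite take_oversize ?(words_size xw) ?(words_size sw) //.
by case: eqP => [->|]; rewrite ?andbF.
Qed.

Lemma bordered_rank_below (w : n.-tuple 'I_k) : bordered (wordval w) ->
  bordered_rank w = (num_below (wordval w)).+1.
Proof.
move=> bw; have ww := wordval_words w.
have -> : (num_below (wordval w)).+1 =
    num_below (wordval w) + num_prefix (wordval w).
  by rewrite num_prefix_word // bw addn1.
rewrite /bordered_rank.
rewrite (card_words n k (fun x => bordered x && lexle x (wordval w))).
apply: count_add => x xw; case: bordered => //=.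
rewrite take_oversize ?(words_size xw) ?(words_size ww) // /lexle.
case: eqP => [->|_]; last by rewrite addn0.
by rewrite lexlt_irr.
Qed.

End Rank.

(** * Structured programs and their compilation *)

Inductive binop := Add | Sub | Mul.

Definition binop_eval (o : binop) : nat -> nat -> nat :=
  match o with Add => addn | Sub => subn | Mul => muln end.

Definition binop_instr (o : binop) : nat -> nat -> nat -> instr :=
  match o with Add => IAdd | Sub => ISub | Mul => IMul end.

(* Structured programs over registers 0..15 and a heap; register 16 is reserved
   for address computations and heap cell i lives in RAM register 17 + i. *)
Inductive cmd :=
  | CSkip
  | CSet of nat & nat
  | COp of binop & nat & nat & nat
  | CLoad of nat & nat
  | CStore of nat & nat
  | CSeq of cmd & cmd
  | CIf of nat & cmd & cmd
  | CWhile of nat & cmd.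

Local Notation "c1 ;; c2" := (CSeq c1 c2) (at level 90, right associativity).

Local Notation num_regs := 16 (only parsing).
Local Notation heap_base := 17 (only parsing).

Fixpoint wf_cmd (c : cmd) : bool :=
  match c with
  | CSkip => true
  | CSet d _ => d < num_regs
  | COp _ d a b => [&& d < num_regs, a < num_regs & b < num_regs]
  | CLoad d a | CStore d a => (d < num_regs) && (a < num_regs)
  | CSeq c1 c2 => wf_cmd c1 && wf_cmd c2
  | CIf a c1 c2 => [&& a < num_regs, wf_cmd c1 & wf_cmd c2]
  | CWhile a c => (a < num_regs) && wf_cmd c
  end.

(** Jump targets are absolute, hence the argument [pc]. A heap access takes three instructions,
    since the address is first shifted by [heap_base] in register 16. *)
Fixpoint compile (pc : nat) (c : cmd) : program :=
  match c with
  | CSkip => [::]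
  | CSet d v => [:: IConst d v]
  | COp o d a b => [:: binop_instr o d a b]
  | CLoad d a => [:: IConst 16 heap_base; IAdd 16 16 a; ILoad d 16]
  | CStore a s => [:: IConst 16 heap_base; IAdd 16 16 a; IStore 16 s]
  | CSeq c1 c2 =>
      let p1 := compile pc c1 in p1 ++ compile (pc + size p1) c2
  | CIf a c1 c2 =>
      let p1 := compile pc.+1 c1 in
      let p2 := compile (pc + (size p1).+2) c2 in
      IJz a (pc + (size p1).+2) ::
        p1 ++ IJmp (pc + (size p1).+2 + size p2) :: p2
  | CWhile a c =>
      let p := compile pc.+1 c in
      IJz a (pc + (size p).+2) :: rcons p (IJmp pc)
  end.

(* The arguments are the elapsed time, the registers and the heap. *)
Definition assertion := nat -> seq nat -> (nat -> nat) -> Prop.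

(** The fuel bounds the number of iterations and so enforces termination. Each test and each jump
    back is charged one unit. *)
Fixpoint wp_loop (body : assertion -> assertion) (a : nat) (Q : assertion)
    (fuel : nat) : assertion := fun t R A =>
  if nth 0 R a == 0 then Q t.+1 R A else
  if fuel is f.+1 then body (fun t' => wp_loop body a Q f t'.+1) t.+1 R A
  else False.

(* Total correctness; H bounds the accessed heap indices, hence the space. *)
Fixpoint wp (H : nat) (c : cmd) (Q : assertion) : assertion := fun t R A =>
  match c with
  | CSkip => Q t R A
  | CSet d v => Q t.+1 (set_nth 0 R d v) A
  | COp o d a b =>
      Q t.+1 (set_nth 0 R d (binop_eval o (nth 0 R a) (nth 0 R b))) A
  | CLoad d a => nth 0 R a < H /\ Q t.+3 (set_nth 0 R d (A (nth 0 R a))) A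
  | CStore a s => nth 0 R a < H /\ Q t.+3 R (upd A (nth 0 R a) (nth 0 R s))
  | CSeq c1 c2 => wp H c1 (wp H c2 Q) t R A
  | CIf a c1 c2 =>
      if nth 0 R a == 0 then wp H c2 Q t.+1 R A
      else wp H c1 (fun t' => Q t'.+1) t.+1 R A
  | CWhile a c => exists fuel, wp_loop (wp H c) a Q fuel t R A
  end.

Lemma wp_skip H Q t R A : wp H CSkip Q t R A = Q t R A.
Proof. by []. Qed.

Lemma wp_set H d v Q t R A :
  wp H (CSet d v) Q t R A = Q t.+1 (set_nth 0 R d v) A.
Proof. by []. Qed.

Lemma wp_op H o d a b Q t R A : wp H (COp o d a b) Q t R A =
  Q t.+1 (set_nth 0 R d (binop_eval o (nth 0 R a) (nth 0 R b))) A.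
Proof. by []. Qed.

Lemma wp_load H d a Q t R A : wp H (CLoad d a) Q t R A =
  (nth 0 R a < H /\ Q t.+3 (set_nth 0 R d (A (nth 0 R a))) A).
Proof. by []. Qed.

Lemma wp_store H a s Q t R A : wp H (CStore a s) Q t R A =
  (nth 0 R a < H /\ Q t.+3 R (upd A (nth 0 R a) (nth 0 R s))).
Proof. by []. Qed.

Lemma wp_seq H c1 c2 Q t R A :
  wp H (c1 ;; c2) Q t R A = wp H c1 (wp H c2 Q) t R A.
Proof. by []. Qed.

Lemma wp_if H a c1 c2 Q t R A : wp H (CIf a c1 c2) Q t R A =
  if nth 0 R a == 0 then wp H c2 Q t.+1 R A
  else wp H c1 (fun t' => Q t'.+1) t.+1 R A.
Proof. by []. Qed.

Lemma wp_mono H c (Q Q' : assertion) t R A :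
  (forall t R A, Q t R A -> Q' t R A) -> wp H c Q t R A -> wp H c Q' t R A.
Proof.
elim: c Q Q' t R A => [|d v|o d a b|d a|a s|c1 IH1 c2 IH2|a c1 IH1 c2 IH2|a c IH]
  Q Q' t R A QQ' /=; try by [exact: QQ'|case=> ? /QQ'].
- by apply: IH1 => *; apply: IH2 QQ' _.
- by case: eqP => _; [apply: IH2|apply: IH1 => *; apply: QQ'].
case=> f wf; exists f; elim: f t R A wf => [|f IHf] t R A /=; case: eqP => // _;
  try exact: QQ'.
by apply: IH => *; apply: IHf.
Qed.

(** The variant [v] bounds the iterations left; the loop may exit while [v] is still positive, as
    the search for a letter does. *)
Lemma wp_while H a c (Q : assertion) (I : nat -> assertion) v t R A :
  I v t R A ->
  (forall v t R A, I v t R A ->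
    if nth 0 R a == 0 then Q t.+1 R A
    else if v is v'.+1 then wp H c (fun t' => I v' t'.+1) t.+1 R A
    else False) ->
  wp H (CWhile a c) Q t R A.
Proof.
move=> Iv step_I; exists v; elim: v t R A Iv => [|v IHv] t R A /step_I /=.
  by [].
by case: eqP => // _; apply: wp_mono => *; apply: IHv.
Qed.

(** * Machine executions and correctness of the compilation *)

Inductive reach (p : program) (S : nat) :
    nat -> nat -> memory -> nat -> memory -> Prop :=
  | Reach0 pc m : reach p S 0 pc m pc m
  | ReachS u pc m pc' m' : ~~ halted p pc ->
      all (fun i => i < S) (accessed p pc m) ->
      reach p S u (step p pc m).1 (step p pc m).2 pc' m' ->
      reach p S u.+1 pc m pc' m'.

Lemma reach_trans p S u1 u2 pc1 m1 pc2 m2 pc3 m3 :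
  reach p S u1 pc1 m1 pc2 m2 -> reach p S u2 pc2 m2 pc3 m3 ->
  reach p S (u1 + u2) pc1 m1 pc3 m3.
Proof. by move=> r1 r2; elim: r1 r2 => // *; apply: ReachS; auto. Qed.

Lemma reach_run p S u pc m pc' m' :
  reach p S u pc m pc' m' -> halted p pc' -> run p u pc m = Some m'.
Proof.
elim=> [{}pc {}m /= ->|{}u {}pc {}m {}pc' {}m' /= /negbTE -> _ _ IH /IH] //.
by case: step.
Qed.

Lemma reach_space_ok p S u pc m pc' m' :
  reach p S u pc m pc' m' -> space_ok p u S pc m.
Proof.
elim=> [{}pc {}m|{}u {}pc {}m {}pc' {}m' /= /negbTE -> -> _] /=.
  by case: halted.
by case: step.
Qed.

Definition code_at (p : program) (pc : nat) (l : program) : Prop :=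
  forall i, i < size l -> cur p (pc + i) = nth IHalt l i.

Lemma code_at_cat p pc l1 l2 : code_at p pc (l1 ++ l2) ->
  code_at p pc l1 /\ code_at p (pc + size l1) l2.
Proof.
move=> h; split => i il.
  by rewrite h ?nth_cat ?il // size_cat; lia.
rewrite -addnA h ?nth_cat ?size_cat; last by lia.
by rewrite ltnNge leq_addr addKn.
Qed.

Lemma code_at_cons p pc i l : code_at p pc (i :: l) ->
  cur p pc = i /\ code_at p pc.+1 l.
Proof.
by rewrite -cat1s => /code_at_cat[/(_ 0 isT)]; rewrite addn0 addn1.
Qed.

Lemma reach1 p S pc m pc' m' : ~~ halted p pc ->
  all (fun i => i < S) (accessed p pc m) -> step p pc m = (pc', m') ->
  reach p S 1 pc m pc' m'.
Proof. by move=> ? ? e; apply: ReachS => //; rewrite e; apply: Reach0. Qed.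

Definition represents (m : memory) (R : seq nat) (A : nat -> nat) : Prop :=
  (forall i, i < num_regs -> m i = nth 0 R i) /\
  (forall i, m (heap_base + i) = A i).

Lemma represents_upd m R A d v : d < num_regs -> represents m R A ->
  represents (upd m d v) (set_nth 0 R d v) A.
Proof.
move=> dn [mR mA]; split=> i; rewrite /upd.
  by move=> i_lt; rewrite nth_set_nth /= mR.
by rewrite mA; case: eqP => //; lia.
Qed.

Lemma represents_tmp m R A v : represents m R A -> represents (upd m 16 v) R A.
Proof.
move=> [mR mA]; split=> i; rewrite /upd; last by case: eqP => //; lia.
by move=> i_lt; rewrite mR //; case: eqP => //; lia.
Qed.

Lemma represents_heap m R A i v : represents m R A ->
  represents (upd m (heap_base + i) v) R (upd A i v).
Proof.
move=> [mR mA]; split=> j; rewrite /upd; last by rewrite eqn_add2l mA.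
by move=> j_lt; rewrite mR //; case: eqP => //; lia.
Qed.

(** Induction on the command. The argument [t + u] of [Q] identifies the cost counted by [wp] with
    the number of machine steps. *)
Lemma compile_correct H S p c pc (Q : assertion) t R A m :
  wf_cmd c -> heap_base + H <= S -> code_at p pc (compile pc c) ->
  represents m R A -> wp H c Q t R A ->
  exists u m' R' A', [/\ reach p S u pc m (pc + size (compile pc c)) m',
    represents m' R' A' & Q (t + u) R' A'].
Proof.
move=> wfc HS; elim: c pc Q t R A m wfc.
- move=> pc Q t R A m _ _ mRA QR; exists 0, m, R, A.
  by rewrite /= !addn0; split=> //; apply: Reach0.
- move=> d v pc Q t R A m /= dn /code_at_cons[pcE _] mRA QR.
  exists 1, (upd m d v), (set_nth 0 R d v), A; rewrite !addn1.
  split=> //; last exact: represents_upd.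
  apply: reach1; rewrite /halted /accessed /step pcE //=; lia.
- move=> o d a b pc Q t R A m /= /and3P[dn an bn] /code_at_cons[pcE _] mRA QR.
  exists 1, (upd m d (binop_eval o (nth 0 R a) (nth 0 R b))).
  exists (set_nth 0 R d (binop_eval o (nth 0 R a) (nth 0 R b))), A.
  rewrite !addn1; split=> //; last exact: represents_upd.
  case: (mRA) => mR _; rewrite -!mR //.
  by apply: reach1; case: o QR pcE => _ pcE;
    rewrite /halted /accessed /step pcE //=; lia.
- move=> d a pc Q t R A m /= /andP[dn an].
  case/code_at_cons=> pcE0 /code_at_cons[pcE1 /code_at_cons[pcE2 _]] mRA [aH QR].
  case: (mRA) => mR mA.
  set m1 := upd m 16 heap_base; set m2 := upd m1 16 (heap_base + nth 0 R a).
  have m2_16 : m2 16 = heap_base + nth 0 R a by [].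
  have mRA2 : represents m2 R A by do 2! apply: represents_tmp.
  have m1a : m1 a = nth 0 R a by rewrite /m1 /upd mR //; case: eqP => //; lia.
  exists 3, (upd m2 d (A (nth 0 R a))), (set_nth 0 R d (A (nth 0 R a))), A.
  rewrite !addn3; split=> //; last exact: represents_upd.
  apply: (@reach_trans _ _ 1 2 _ _ pc.+1 m1);
    last apply: (@reach_trans _ _ 1 1 _ _ pc.+2 m2).
  + apply: reach1; rewrite /halted /accessed /step pcE0 //=; lia.
  + apply: reach1; rewrite /halted /accessed /step pcE1 //=; first lia.
    by rewrite m1a /m2 {3}/m1 /upd.
  + apply: reach1; rewrite /halted /accessed /step pcE2 //=.
      by rewrite m2_16; lia.
    by rewrite m2_16 (proj2 mRA2).
- move=> a s pc Q t R A m /= /andP[an sn].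
  case/code_at_cons=> pcE0 /code_at_cons[pcE1 /code_at_cons[pcE2 _]] mRA [aH QR].
  case: (mRA) => mR mA.
  set m1 := upd m 16 heap_base; set m2 := upd m1 16 (heap_base + nth 0 R a).
  have m2_16 : m2 16 = heap_base + nth 0 R a by [].
  have mRA2 : represents m2 R A by do 2! apply: represents_tmp.
  have m1a : m1 a = nth 0 R a by rewrite /m1 /upd mR //; case: eqP => //; lia.
  exists 3, (upd m2 (heap_base + nth 0 R a) (nth 0 R s)), R.
  exists (upd A (nth 0 R a) (nth 0 R s)).
  rewrite !addn3; split=> //; last exact: represents_heap.
  apply: (@reach_trans _ _ 1 2 _ _ pc.+1 m1);
    last apply: (@reach_trans _ _ 1 1 _ _ pc.+2 m2).
  + apply: reach1; rewrite /halted /accessed /step pcE0 //=; lia.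
  + apply: reach1; rewrite /halted /accessed /step pcE1 //=; first lia.
    by rewrite m1a /m2 {3}/m1 /upd.
  + apply: reach1; rewrite /halted /accessed /step pcE2 //=.
      by rewrite m2_16; lia.
    by rewrite m2_16 (proj1 mRA2).
- move=> c1 IH1 c2 IH2 pc Q t R A m /= /andP[wf1 wf2] /code_at_cat[at1 at2] mRA.
  case/(IH1 _ _ _ _ _ _ wf1 at1 mRA) => u1 [m1 [R1 [A1 [r1 mRA1]]]].
  case/(IH2 _ _ _ _ _ _ wf2 at2 mRA1) => u2 [m2 [R2 [A2 [r2 mRA2 QR]]]].
  exists (u1 + u2), m2, R2, A2; rewrite size_cat !addnA; split=> //.
  exact: reach_trans r1 r2.
- move=> a c1 IH1 c2 IH2 pc Q t R A m /= /and3P[an wf1 wf2].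
  set p1 := compile pc.+1 c1; set p2 := compile _ c2.
  case/code_at_cons=> pcE /code_at_cat[at1 /code_at_cons[pcE1 at2]] mRA.
  have [mR _] := mRA.
  have -> : pc + (size (p1 ++ IJmp (pc + (size p1).+2 + size p2) :: p2)).+1 =
      pc + (size p1).+2 + size p2 by rewrite size_cat /=; lia.
  case: eqP => [Ra0|Ra].
    rewrite addSn -!addnS in at2.
    case/(IH2 _ _ _ _ _ _ wf2 at2 mRA) => u [m' [R' [A' [r mRA' QR]]]].
    exists u.+1, m', R', A'; split=> //; last by rewrite addnS -addSn.
    rewrite -add1n; apply: reach_trans r.
    apply: reach1; rewrite /halted /accessed /step pcE //=; first lia.
    by rewrite mR // Ra0 eqxx.
  case/(IH1 _ _ _ _ _ _ wf1 at1 mRA) => u [m' [R' [A' [r mRA' QR]]]].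
  exists (1 + (u + 1)), m', R', A'; split=> //; last first.
    by move: QR; rewrite (_ : (t.+1 + u).+1 = t + (1 + (u + 1))) //; lia.
  apply: (@reach_trans _ _ _ _ _ _ pc.+1 m); last apply: reach_trans r _.
    apply: reach1; rewrite /halted /accessed /step pcE //=; first lia.
    by rewrite mR //; case: eqP.
  by apply: reach1; rewrite /halted /accessed /step pcE1.
move=> a c IH pc Q t R A m /= /andP[an wfc].
set q := compile pc.+1 c; rewrite -cats1.
case/code_at_cons=> pcE /code_at_cat[atc /code_at_cons[pcE1 _]] mRA [f].
rewrite size_cat addn1.
(* Inner induction on the fuel; an iteration costs one test, the body and one jump. *)
elim: f t R A m mRA => [|f IHf] t R A m mRA /=.
all: have [mR _] := mRA; case: eqP => // Ra.
1, 2: move=> QR; exists 1, m, R, A; rewrite addn1; split=> //;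
    apply: reach1; rewrite /halted /accessed /step pcE //=; try lia;
    by rewrite mR // Ra eqxx.
case/(IH _ _ _ _ _ _ wfc atc mRA) => u1 [m1 [R1 [A1 [r1 mRA1]]]].
case/(IHf _ _ _ _ mRA1) => u2 [m2 [R2 [A2 [r2 mRA2 QR]]]].
exists (1 + (u1 + (1 + u2))), m2, R2, A2; split=> //; last first.
  by move: QR; rewrite (_ : _ + _ = t + (1 + (u1 + (1 + u2)))) //; lia.
apply: (@reach_trans _ _ _ _ _ _ pc.+1 m).
  apply: reach1; rewrite /halted /accessed /step pcE //=; first lia.
  by rewrite mR //; case: eqP.
apply: reach_trans r1 _; apply: reach_trans r2.
by apply: reach1; rewrite /halted /accessed /step pcE1.
Qed.

(* Loading a register through itself needs no scratch register, so that the
   output can overwrite all the registers. *)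
Lemma reach_deref p S pc j m base :
  (forall i, i < heap_base -> m i = base + i) ->
  heap_base <= base -> base + heap_base <= S -> j <= heap_base ->
  code_at p pc [seq ILoad i i | i <- iota 0 j] ->
  exists m', reach p S j pc m (pc + j) m' /\
    forall i, m' i = if i < j then m (base + i) else m i.
Proof.
move=> mb hb bS; elim: j => [|j IHj] jh.
  by move=> _; exists m; rewrite addn0; split=> //; apply: Reach0.
rewrite -addn1 iotaD map_cat => /code_at_cat[/IHj[|m' [r m'E]]]; first by lia.
rewrite size_map size_iota => /code_at_cons[pcE _].
have m'j : m' j = base + j by rewrite m'E ltnn mb //; lia.
exists (upd m' j (m (base + j))); split.
  apply: reach_trans r _; rewrite addnA addn1.
  apply: reach1; rewrite /halted /accessed /step pcE //= m'j; first lia.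
  by rewrite m'E; case: ltnP => //; lia.
move=> i; rewrite /upd; case: eqP => [->|ij]; first by rewrite addn1 ltnSn.
by rewrite m'E addn1 (_ : (i < j.+1) = (i < j)) //; lia.
Qed.

(** * The unranking program *)

(* The first vm letters of the candidate word are stored in the heap from index n
   on (letter i at n + i); the cell 2n + b receives the number of unbordered
   words of length b that agree with them. *)
Local Notation vr := 0 (only parsing).
Local Notation vn := 1 (only parsing).
Local Notation vk := 2 (only parsing).
Local Notation va := 3 (only parsing).
Local Notation vm := 4 (only parsing).
Local Notation vb := 5 (only parsing).
Local Notation vj := 6 (only parsing).
Local Notation vi := 7 (only parsing).
Local Notation vd := 8 (only parsing).
Local Notation vP := 9 (only parsing).
Local Notation vS := 10 (only parsing).
Local Notation vT := 11 (only parsing).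
Local Notation vx := 12 (only parsing).
Local Notation vy := 13 (only parsing).
Local Notation vz := 14 (only parsing).
Local Notation v1 := 15 (only parsing).

Definition regs r n k a m b j i d P S T x y z : seq nat :=
  [:: r; n; k; a; m; b; j; i; d; P; S; T; x; y; z; 1].

(** Comparisons are encoded by truncated subtraction: [vm - vi] is nonzero exactly when [vi < vm],
    and two letters are equal exactly when both of their differences vanish. *)
Definition prod_body : cmd :=
  COp Sub vx vm vi;;
  COp Sub vy vd vi;;
  CIf vx
    (CIf vy CSkip
      (COp Add vx vn vi;; CLoad vx vx;;
       COp Sub vz vi vd;; COp Add vz vn vz;; CLoad vz vz;;
       COp Sub vy vx vz;; COp Sub vz vz vx;; COp Add vy vy vz;;
       CIf vy (CSet vP 0) CSkip))
    (CIf vy (COp Mul vP vP vk) CSkip);;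
  COp Add vi vi v1;;
  COp Sub vx vb vi.

(** Register [v1] holds 1, so multiplying by it copies a register. *)
Definition prod_cmd : cmd :=
  CSet vP 1;; COp Mul vi vj v1;; COp Sub vd vb vj;; COp Sub vx vb vi;;
  CWhile vx prod_body.

(** The guard [b + 1 - 2j] is nonzero exactly when [j] is at most half of [b]. *)
Definition sum_body : cmd :=
  prod_cmd;;
  COp Add vz vn vn;; COp Add vz vz vj;; CLoad vz vz;;
  COp Mul vP vP vz;; COp Add vS vS vP;; COp Add vj vj v1;;
  COp Add vx vj vj;; COp Add vy vb v1;; COp Sub vx vy vx.

Definition sum_cmd : cmd :=
  CSet vS 0;; CSet vj 1;;
  COp Add vx vj vj;; COp Add vy vb v1;; COp Sub vx vy vx;;
  CWhile vx sum_body.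

Definition count_body : cmd :=
  COp Sub vx vm vb;; CIf vx CSkip (COp Mul vT vT vk);;
  COp Add vb vb v1;;
  sum_cmd;;
  COp Add vx vn vn;; COp Add vx vx vb;; COp Sub vy vT vS;; CStore vx vy;;
  COp Sub vx vn vb.

Definition count_cmd : cmd :=
  CSet vb 0;; CSet vT 1;; COp Sub vx vn vb;; CWhile vx count_body.

(** The difference in [vx] is both the next rank and the loop guard: it is zero exactly when the
    rank fits the current letter. *)
Definition letter_body : cmd :=
  COp Add va va v1;;
  COp Add vy vn vm;; COp Sub vy vy v1;; CStore vy va;;
  count_cmd;;
  COp Sub vx vr vS;; CIf vx (COp Mul vr vx v1) CSkip.

Definition position_body : cmd :=
  COp Add vm vm v1;; CSet va 0;; CSet vx 1;; CWhile vx letter_body;;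
  COp Sub vx vn vm.

Definition output_body : cmd :=
  COp Add vz vn vy;; CLoad vz vz;; CStore vm vz;;
  COp Add vm vm v1;; COp Add vy vy v1;; COp Sub vx vn vy.

(** Letter [l] must end in RAM register [l], which for [l >= 17] is heap cell [l - 17]. The first 17
    letters belong in registers still in use and are moved last. *)
Definition output_cmd : cmd :=
  CSet vm 0;; CSet vy heap_base;; COp Sub vx vn vy;; CWhile vx output_body.

(** Register [i] receives [n + 17 + i], the RAM address of letter [i]; register 15 comes first, as
    [n + 32], and the others are computed from it. *)
Definition pointers_cmd : cmd :=
  CSet 15 32;; COp Add 15 15 vn;;
  foldr (fun i c => CSet i (15 - i);; COp Sub i 15 i;; c) CSkip (iota 0 15).

Definition unrank_cmd : cmd :=
  CSet v1 1;; COp Sub vx vn vm;; CWhile vx position_body;;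
  output_cmd;; pointers_cmd.

(* One instruction at a time, with the register list evaluated at each step to
   keep it from growing. *)
Local Ltac wp_steps :=
  repeat first
    [ rewrite wp_seq | rewrite wp_skip
    | rewrite wp_set; cbn [set_nth] | rewrite wp_op; cbn [set_nth nth binop_eval]
    | rewrite wp_if; cbn [nth]
    | rewrite wp_load; cbn [set_nth nth]; split; [lia|]
    | rewrite wp_store; cbn [nth]; split; [lia|] ].

Local Opaque wp.

(** * Correctness and running time of the commands *)

Section Spec.

Variables n k H : nat.
Hypotheses (n_gt0 : 0 < n) (n_H : 3 * n < H).

(** [P] starts at 1 and collects the factors of [num_echoS]; the starting count of unbordered words
    is multiplied in afterwards by [sum_body]. *)
Lemma prod_cmd_spec r a m b j i d P S T x y z A p t (Q : assertion) :
  0 < j -> j + j <= b -> b <= n -> m <= n ->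
  (forall l, l < m -> A (n + l) = p l) ->
  (forall l, l < m -> 0 < p l <= k) ->
  (forall t' i d P x y z, t' <= t + 30 * n ->
    num_agree_unbordered k m p j * P = num_echo k m p (b - j) j b ->
    Q t' (regs r n k a m b j i d P S T x y z) A) ->
  wp H prod_cmd Q t (regs r n k a m b j i d P S T x y z) A.
Proof.
move=> j0 jb bn mn Ap pk HQ; rewrite /prod_cmd /regs; wp_steps.
pose I v t' R A' := exists i P y z,
  [/\ i + v = b, j <= i, t' + 29 * v <= t + 29 * (b - j) + 4,
      num_agree_unbordered k m p j * P = num_echo k m p (b - j) j i &
      R = regs r n k a m b j i (b - j) P S T v y z /\ A' = A].
apply: (@wp_while _ _ _ _ I (b - j)).
  exists j, 1, y, z; rewrite !muln1 num_echo_start; last by lia.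
  by split=> //; lia.
move=> v t' R A' {i P y z} [i [P [y [z [iv ji ht hP [-> ->]]]]]].
rewrite /regs; cbn [nth]; case: v iv ht => [|v] iv ht.
  have ib : i = b by lia.
  by rewrite /= ib in hP *; apply: HQ => //; lia.
have d_gt0 : 0 < b - j by lia.
have := num_echoS pk d_gt0 ji; rewrite -hP -mulnA => hS.
have bi : b - (i + 1) = v by lia.
(* Common end of all branches: only the new factor and the elapsed time remain to be checked. *)
have step_I t0 P' y' z' : t0 <= t' + 29 ->
    P' = P * (if i < m then (if i < b - j then 1 else p i == p (i - (b - j)))
              else (if i < b - j then k else 1)) ->
    I v t0 (regs r n k a m b j (i + 1) (b - j) P' S T (b - (i + 1)) y' z') A.
  move=> t0t' P'E; exists i.+1, P', y', z'; rewrite hS -P'E bi addn1.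
  by split=> //; lia.
rewrite /prod_body; wp_steps.
case: (ltnP i m) step_I => im step_I.
  have -> : (m - i == 0) = false by lia.
  case: (ltnP i (b - j)) step_I => id step_I.
    have -> : (b - j - i == 0) = false by lia.
    by apply: step_I; lia.
  have -> : (b - j - i == 0) = true by lia.
  wp_steps; rewrite !Ap //; last by lia.
  case: (p i =P p (i - (b - j))) step_I => e step_I.
    by rewrite e subnn /=; apply: step_I; lia.
  have -> : (p i - p (i - (b - j)) + (p (i - (b - j)) - p i) == 0) = false by lia.
  by apply: step_I; lia.
have -> : (m - i == 0) = true by lia.
case: (ltnP i (b - j)) step_I => id step_I.
  have -> : (b - j - i == 0) = false by lia.
  by apply: step_I; lia.
have -> : (b - j - i == 0) = true by lia.
by apply: step_I; lia.
Qed.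

Lemma sum_cmd_spec r a m b j i d P S T x y z A p t (Q : assertion) :
  0 < b -> b <= n -> m <= n ->
  (forall l, l < m -> A (n + l) = p l) ->
  (forall l, l < m -> 0 < p l <= k) ->
  (forall l, 0 < l < b -> A (n + n + l) = num_agree_unbordered k m p l) ->
  (forall t' j i d P x y z, t' <= t + 55 * (n * n) ->
    Q t' (regs r n k a m b j i d P (num_agree_bordered k m p b) T x y z) A) ->
  wp H sum_cmd Q t (regs r n k a m b j i d P S T x y z) A.
Proof.
move=> b0 bn mn Ap pk Au HQ; rewrite /sum_cmd /regs; wp_steps.
(* A round costs at most [30 * n] for the product and 14 for the rest. *)
pose I v t' R A' := exists j i d P y z,
  [/\ j + v = b./2.+1, 0 < j,
      t' + (30 * n + 14) * v <= t + (30 * n + 14) * b./2 + 5 &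
      R = regs r n k a m b j i d P
        (\sum_(1 <= l < j) num_echo k m p (b - l) l b) T (b + 1 - (j + j)) y z
      /\ A' = A].
have nn : 0 < n * n by rewrite muln_gt0 n_gt0.
apply: (@wp_while _ _ _ _ I b./2).
  exists 1, i, d, P, (b + 1), z; rewrite big_geq //.
  by split=> //; lia.
move=> v t' R A' {j i d P y z} [j [i [d [P [y [z [jv j0 ht [-> ->]]]]]]]].
rewrite /regs; cbn [nth]; case: v jv ht => [|v] jv ht.
  have jb : j = b./2.+1 by lia.
  have -> : (b + 1 - (j + j) == 0) = true by lia.
  rewrite jb -num_agree_bordered_sum; apply: HQ.
  have : (30 * n + 14) * b./2 <= (30 * n + 14) * n by rewrite leq_mul2l; lia.
  by nia.
have -> : (b + 1 - (j + j) == 0) = false by lia.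
rewrite /sum_body wp_seq; apply: (@prod_cmd_spec _ _ _ _ _ _ _ _ _ _ _ _ _ _ p) => //; try lia.
move=> t1 {}i {}d {}P {}x {}y {}z ht1 hP; rewrite /regs; wp_steps.
exists j.+1, i, d; do 3 eexists; split; last first.
(* Since [2j <= b] and [j > 0], we have [j < b], so the table entry is already filled. *)
- rewrite Au; last by lia.
  rewrite mulnC hP big_nat_recr //= addn1; split; reflexivity.
- by lia.
- by [].
- by lia.
Qed.

Lemma count_cmd_spec r a m b j i d P S T x y z A p t (Q : assertion) :
  m <= n ->
  (forall l, l < m -> A (n + l) = p l) ->
  (forall l, l < m -> 0 < p l <= k) ->
  (forall t' b j i d P T x y z A', t' <= t + 80 * (n * n * n) ->
    (forall l, l < n + n -> A' l = A l) ->
    Q t' (regs r n k a m b j i d P (num_agree_bordered k m p n) T x y z) A') ->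
  wp H count_cmd Q t (regs r n k a m b j i d P S T x y z) A.
Proof.
move=> mn Ap pk HQ; rewrite /count_cmd /regs; wp_steps.
(* [S] is left over from the previous round, hence meaningful only for [b > 0]; the table lies above
   [2n], so the letters stay intact. *)
pose I v t' R A' := exists b j i d P S y z,
  [/\ b + v = n, t' + (55 * (n * n) + 16) * v <= t + (55 * (n * n) + 16) * n + 3,
      (forall l, l < n + n -> A' l = A l),
      (forall l, 0 < l <= b -> A' (n + n + l) = num_agree_unbordered k m p l) &
      (0 < b -> S = num_agree_bordered k m p b) /\
      R = regs r n k a m b j i d P S (num_agree k m p b) v y z].
have nn : 0 < n * n by rewrite muln_gt0 n_gt0.
apply: (@wp_while _ _ _ _ I n).
  exists 0, j, i, d, P, S, y, z; rewrite subn0 num_agree0.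
  by split=> //; lia.
move=> v t' R A' {b j i d P S y z}.
move=> [b [j [i [d [P [S [y [z [bv ht A'A Au [hS ->]]]]]]]]]].
rewrite /regs; cbn [nth]; case: v bv ht => [|v] bv ht.
  rewrite eqxx; have bE : b = n by lia.
  rewrite hS; last by lia.
  by rewrite bE; apply: HQ => //; nia.
have -> : (v.+1 == 0) = false by [].
have step_I t0 T' x' : t0 <= t' + 6 -> T' = num_agree k m p b.+1 ->
    wp H (sum_cmd;; COp Add vx vn vn;; COp Add vx vx vb;; COp Sub vy vT vS;;
          CStore vx vy;; COp Sub vx vn vb) (fun t => I v t.+1) t0
      (regs r n k a m (b + 1) j i d P S T' x' y z) A'.
  move=> ht0 ->; rewrite addn1 wp_seq; apply: (@sum_cmd_spec _ _ _ _ _ _ _ _ _ _ _ _ _ _ p) => //; try lia.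
    by move=> l lm; rewrite A'A ?Ap //; lia.
  move=> t1 {}j {}i {}d {}P {}x {}y {}z ht1; rewrite /regs; wp_steps.
  exists b.+1, j, i, d, P; do 3 eexists; split; last first.
  + by split; last (rewrite (_ : n - b.+1 = v); last lia); reflexivity.
  + move=> l lb; rewrite /upd eqn_add2l; case: eqP => [->|lb'].
      by rewrite num_agree_unborderedE.
    by apply: Au; lia.
  + by move=> l ln; rewrite /upd; case: eqP => [|_]; [lia|apply: A'A].
  + by lia.
  + by lia.
rewrite /count_body; rewrite wp_seq wp_op; cbn [set_nth nth binop_eval].
rewrite wp_seq wp_if; cbn [nth].
have := num_agreeS pk b; case: (ltnP b m) => bm TE.
  have -> : (m - b == 0) = false by lia.
  rewrite wp_skip wp_seq wp_op; cbn [set_nth nth binop_eval].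
  by apply: step_I; lia.
have -> : (m - b == 0) = true by lia.
rewrite wp_op wp_seq wp_op; cbn [set_nth nth binop_eval].
by apply: step_I; lia.
Qed.

(** Here [r0] is the original rank and [r] the rank among the bordered words starting with [s]; the
    body extends [s] by one letter and keeps this relation. *)
Lemma position_body_spec r m s a b j i d P S T x y z A t r0 (Q : assertion) :
  size s = m -> m < n -> all (fun c => 0 < c <= k) s ->
  (forall l, l < m -> A (n + l) = nth 0 s l) ->
  r0 = r + num_below n k s -> 0 < r <= num_prefix n k s ->
  (forall t' r c a b j i d P S T x y z A',
    t' <= t + 100 * (n * n * n * k) + 10 -> 0 < c <= k ->
    (forall l, l < m.+1 -> A' (n + l) = nth 0 (rcons s c) l) ->
    r0 = r + num_below n k (rcons s c) ->
    0 < r <= num_prefix n k (rcons s c) ->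
    x = n - m.+1 -> Q t' (regs r n k a m.+1 b j i d P S T x y z) A') ->
  wp H position_body Q t (regs r n k a m b j i d P S T x y z) A.
Proof.
move=> sm mn ks As r0E rs HQ; rewrite /position_body /regs; wp_steps.
have nnn : 0 < n * n * n by rewrite !muln_gt0 n_gt0.
have r0_le : r0 <= num_below n k (rcons s k.+1).
  by rewrite num_below_rcons_last; lia.
(* For [x = 0] the letter [a] has been chosen; otherwise the letters up to [a] have been rejected
   and [v] remain. *)
pose I v t' R A' := exists r a b j i d P S T x y z,
  [/\ a <= k, t' + 100 * (n * n * n) * v <= t + 100 * (n * n * n) * k + 3,
      (forall l, l < m -> A' (n + l) = nth 0 s l),
      (if x == 0 then
        [/\ 0 < a, A' (n + m) = a, r0 = r + num_below n k (rcons s a) &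
            0 < r <= num_prefix n k (rcons s a)]
       else [/\ a + v = k, r0 = r + num_below n k (rcons s a.+1) & 0 < r]) &
      R = regs r n k a m.+1 b j i d P S T x y z].
apply: (@wp_while _ _ _ _ I k).
  exists r, 0, b, j, i, d, P, S, T, 1, y, z; rewrite addn1.
  split=> //=; try lia.
  by rewrite num_below_rcons1 ?sm //; split=> //; lia.
move=> v t' R A' {r a b j i d P S T x y z r0E rs}.
move=> [r [a [b [j [i [d [P [S [T [x [y [z [ak ht A's hx ->]]]]]]]]]]]]].
rewrite /regs; cbn [nth]; case: eqP hx => [-> | x0].
  case=> a0 A'a r0E rs; wp_steps; apply: (HQ _ _ a) => //; try lia.
  move=> l lm; rewrite nth_rcons sm; case: ltnP => [/A's //|ml].
  have -> : l = m by lia.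
  by rewrite eqxx.
case=> av r0E r0'.
(* Had all [k] letters been rejected, [r0] would exceed the bound [r0_le]. *)
have av' : a < k.
  by rewrite ltn_neqAle ak andbT; apply/eqP => aE; rewrite aE in r0E; lia.
case: v av ht => [|v] av ht; first by lia.
rewrite /letter_body; wp_steps.
have -> : n + m.+1 - 1 = n + m by lia.
set A1 := upd _ _ _.
have A1s l : l < m.+1 -> A1 (n + l) = nth 0 (rcons s (a + 1)) l.
  move=> lm; rewrite /A1 /upd eqn_add2l nth_rcons sm.
  by case: eqP => [->|lm']; [rewrite ltnn|case: ltnP => [/A's //|]; lia].
apply: (@count_cmd_spec r (a + 1) m.+1 b j i d P S T x (n + m) z A1
  (nth 0 (rcons s (a + 1)))).
- by lia.
- exact: A1s.
- move=> l lm; apply: (@all_nthP _ (fun c => 0 < c <= k) (rcons s (a + 1)) 0 _).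
    by rewrite all_rcons ks; lia.
  by rewrite size_rcons sm.
move=> t1 {}b {}j {}i {}d {}P {}T {x0}x {}y {}z A2 ht1 A2A1.
have A2s l : l < m.+1 -> A2 (n + l) = nth 0 (rcons s (a + 1)) l.
  by move=> lm; rewrite A2A1 ?A1s //; lia.
have A2s' l : l < m -> A2 (n + l) = nth 0 s l.
  by move=> lm; rewrite A2s ?nth_rcons ?sm ?lm //; lia.
have -> : num_agree_bordered k m.+1 (nth 0 (rcons s (a + 1))) n =
    num_prefix n k (rcons s (a + 1)).
  by rewrite num_prefixE size_rcons sm.
rewrite addn1 in A2s r0E *.
rewrite /regs; wp_steps; case: eqP => rS.
  exists r, a.+1; do 10 eexists; split; last reflexivity.
  - by [].
  - by lia.
  - exact: A2s'.
  rewrite rS eqxx; split=> //; last by lia.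
  by rewrite A2s // nth_rcons sm ltnn eqxx.
exists (r - num_prefix n k (rcons s a.+1)), a.+1; do 10 eexists.
split; last by rewrite muln1; reflexivity.
- by [].
- by lia.
- exact: A2s'.
case: eqP => // _; split; try lia.
by rewrite num_below_rconsS ?sm // r0E; lia.
Qed.

Lemma output_cmd_spec r m a b j i d P S T x y z A t (Q : assertion) :
  (forall t' m x y z A', t' <= t + 20 * n + 10 ->
    (forall l, l < n -> A' (n + l) = A (n + l)) ->
    (forall l, heap_base + l < n -> A' l = A (n + (heap_base + l))) ->
    Q t' (regs r n k a m b j i d P S T x y z) A') ->
  wp H output_cmd Q t (regs r n k a m b j i d P S T x y z) A.
Proof.
move=> HQ; rewrite /output_cmd /regs; wp_steps.
pose I v t' R A' := exists m z,
  [/\ m + v = n - heap_base, t' + 20 * v <= t + 20 * (n - heap_base) + 3,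
      (forall l, n <= l -> A' l = A l),
      (forall l, l < m -> A' l = A (n + (heap_base + l))) &
      R = regs r n k a m b j i d P S T v (heap_base + m) z].
apply: (@wp_while _ _ _ _ I (n - heap_base)).
  by exists 0, z; split=> //; lia.
move=> v t' R A' {m z} [m [z [mv ht A'A A'm ->]]].
rewrite /regs; cbn [nth]; case: v mv ht => [|v] mv ht.
  rewrite eqxx; apply: HQ; first by lia.
    by move=> l _; apply: A'A; lia.
  by move=> l ln; apply: A'm; lia.
have -> : (v.+1 == 0) = false by [].
rewrite /output_body; wp_steps.
exists m.+1; eexists; split; last first.
- rewrite !addn1 addnS (_ : n - (heap_base + m).+1 = v); [reflexivity|lia].
- move=> l lm; rewrite /upd; case: eqP => [->|lm']; first by apply: A'A; lia.
  by apply: A'm; lia.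
- by move=> l nl; rewrite /upd; case: eqP => [|_]; [lia|apply: A'A].
- by lia.
- by lia.
Qed.

Lemma pointers_cmd_spec r m a b j i d P S T x y z A t (Q : assertion) :
  (forall t' R, t' <= t + 32 ->
    (forall i, i < num_regs -> nth 0 R i = n + heap_base + i) -> Q t' R A) ->
  wp H pointers_cmd Q t (regs r n k a m b j i d P S T x y z) A.
Proof.
move=> HQ; rewrite /pointers_cmd /regs; cbn [foldr iota]; wp_steps.
apply: HQ; first by lia.
by do 16 (case=> [|i0]; [move=> _; cbn [nth]; lia|move: i0]) => [].
Qed.

Lemma unrank_cmd_spec r (Q : assertion) :
  0 < k -> 1 <= r <= num_bordered n k ->
  (forall t R A s, t <= 200 * (n ^ 4 * k) -> s \in words k n ->
    bordered s -> r = (num_below n k s).+1 ->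
    (forall i, i < num_regs -> nth 0 R i = n + heap_base + i) ->
    (forall l, l < n -> A (n + l) = nth 0 s l) ->
    (forall l, heap_base + l < n -> A l = nth 0 s (heap_base + l)) ->
    Q t R A) ->
  wp H unrank_cmd Q 0 (r :: n :: k :: nseq 13 0) (fun=> 0).
Proof.
move=> k0 rB HQ; rewrite /unrank_cmd; cbn [nseq ncons]; wp_steps.
(* The cost of one position, including 2 for the loop test and the jump. *)
pose C := 100 * (n * n * n * k) + 12.
pose I v t' R A := exists m s r' a b j i d P S T y z,
  [/\ size s = m /\ all (fun c => 0 < c <= k) s,
      m + v = n /\ t' + C * v <= C * n + 2,
      (forall l, l < m -> A (n + l) = nth 0 s l),
      r = r' + num_below n k s /\ 0 < r' <= num_prefix n k s &
      R = regs r' n k a m b j i d P S T v y z].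
apply: (@wp_while _ _ _ _ I n).
  exists 0, [::], r; do 10 exists 0.
  by rewrite num_below_nil num_prefix_nil addn0 subn0; split=> //; split=> //; lia.
move=> v t' R A.
move=> [m [s [r' [a [b [j [i [d [P [S [T [y [z [[sm ks] [mv ht] As [rE r'P] ->]]]]]]]]]]]]]].
case: v mv ht => [|v] mv ht; rewrite {1}/regs; cbn [nth].
  rewrite eqxx wp_seq; apply: output_cmd_spec => t1 m1 x1 y1 z1 A1 ht1 A1n A1o.
  refine (@pointers_cmd_spec r' m1 a b j i d P S T x1 y1 z1 A1 t1 Q _).
  move=> t2 R2 ht2 R2n.
  have mn : m = n by lia.
  have sw : s \in words k n by rewrite mem_words sm mn eqxx.
  (* For a full word [num_prefix s] is 0 or 1, and it is at least [r' > 0]; so [s] is bordered and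
     [r' = 1]. *)
  have := num_prefix_word sw; case: (boolP (bordered s)) => bs sP; last by lia.
  apply: (HQ _ _ _ s) => //.
  - have -> : n ^ 4 * k = n * n * n * k * n by rewrite !expnS expn0; lia.
    have : n <= n * n * n * k * n by rewrite leq_pmull // !muln_gt0 n_gt0.
    by rewrite /C in ht; lia.
  - by lia.
  - by move=> l ln; rewrite A1n // As // mn.
  - by move=> l ln; rewrite A1o // As // mn.
have -> : (v.+1 == 0) = false by [].
apply: (@position_body_spec r' m s _ _ _ _ _ _ _ _ _ _ _ _ _ r) => //; first by lia.
move=> t1 r1 c a1 b1 j1 i1 d1 P1 S1 T1 x1 y1 z1 A1 ht1 ck A1s rE1 r1P x1E.
exists m.+1, (rcons s c), r1, a1, b1, j1, i1, d1, P1, S1, T1, y1, z1.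
split=> //.
- by rewrite size_rcons sm all_rcons ck.
- by split; [lia|rewrite /C in ht *; lia].
by rewrite x1E (_ : n - m.+1 = v) //; lia.
Qed.

End Spec.

(** * The complete RAM program *)

Definition unrank_program : program :=
  compile 0 unrank_cmd ++
  [:: IConst 16 1; IAdd 16 15 16] ++ [seq ILoad i i | i <- iota 0 heap_base].

Lemma represents_init r n k :
  represents (init_mem r n k) (r :: n :: k :: nseq 13 0) (fun=> 0).
Proof. by split=> //; do 16 (case=> //). Qed.

(** Register 16 is out of reach of structured commands, so its pointer [n + 33] is set by two raw
    instructions before the final loads. *)
Lemma unrank_program_correct n k r :
  0 < n -> 0 < k -> 1 <= r <= num_bordered n k ->
  exists u m s,
    [/\ u <= 300 * (n ^ 4 * k),
        reach unrank_program (400 * n) u 0 (init_mem r n k)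
          (size unrank_program) m,
        s \in words k n, bordered s /\ r = (num_below n k s).+1 &
        forall i, i < n -> m i = nth 0 s i].
Proof.
move=> n0 k0 rB; set p := unrank_program.
have /code_at_cat[at1 /code_at_cat[at2 at3]] : code_at p 0 p by [].
pose Q t (R : seq nat) A := exists s,
  [/\ t <= 200 * (n ^ 4 * k) /\ s \in words k n,
      bordered s /\ r = (num_below n k s).+1,
      forall i, i < num_regs -> nth 0 R i = n + heap_base + i,
      forall l, l < n -> A (n + l) = nth 0 s l &
      forall l, heap_base + l < n -> A l = nth 0 s (heap_base + l)].
(* The largest heap index used is [3 * n], the table entry for length [n]. *)
have wpQ : wp (3 * n).+1 unrank_cmd Q 0 (r :: n :: k :: nseq 13 0) (fun=> 0).
  by apply: unrank_cmd_spec => // t R A s *; exists s.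
have wf_unrank : wf_cmd unrank_cmd by [].
have HS : heap_base + (3 * n).+1 <= 400 * n by lia.
have [u [m1 [R [A [r1 [mR mA] [s [[ut sw] bs Rn An Ao]]]]]]] :=
  compile_correct wf_unrank HS at1 (represents_init r n k) wpQ.
move: r1 at2 at3; rewrite !add0n; set q := compile 0 unrank_cmd => r1.
case/code_at_cons=> e1 /code_at_cons[e2 _]; rewrite [size [:: _; _]]/= => at3.
have size_p : size p = size q + 2 + heap_base.
  by rewrite /p /unrank_program -/q !size_cat size_map size_iota addnA.
clearbody p q.
pose m2 := upd (upd m1 16 1) 16 (n + heap_base + 16).
have r2 : reach p (400 * n) 2 (size q) m1 (size q + 2) m2.
  rewrite addn2; apply: (@reach_trans _ _ 1 1 _ _ (size q).+1 (upd m1 16 1)).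
    by apply: reach1; rewrite /halted /accessed /step e1 //=; lia.
  apply: reach1; rewrite /halted /accessed /step e2 //=; first lia.
  by rewrite /m2 {2 3}/upd /= mR // Rn // addn1 -addnS.
have m2_ptr i : i < heap_base -> m2 i = n + heap_base + i.
  move=> ih; rewrite /m2 /upd; case: eqP => [-> //|ni].
  by rewrite mR ?Rn //; lia.
have m2_heap i : m2 (heap_base + i) = A i.
  by rewrite /m2 /upd -mA; case: eqP => //; lia.
have [|||m3 [r3 m3E]] := @reach_deref p (400 * n) (size q + 2) heap_base m2
  (n + heap_base) m2_ptr _ _ _ at3; try lia.
exists (u + 2 + heap_base), m3, s; split=> //.
- have : 0 < n ^ 4 * k by rewrite muln_gt0 expn_gt0 n0.
  by lia.
- by rewrite size_p; apply: reach_trans r3; apply: reach_trans r2.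
(* The first 17 letters come from the final loads, the others from the copying loop. *)
move=> i i_n; rewrite m3E; case: ltnP => ih.
  by rewrite (_ : n + heap_base + i = heap_base + (n + i)) ?m2_heap ?An //; lia.
have iE : i = heap_base + (i - heap_base) by lia.
by rewrite iE m2_heap Ao // -iE.
Qed.

Theorem theorem11 :
  exists (p : program) (c : nat),
    forall n k r : nat, 1 <= n -> 2 <= k -> 1 <= r <= num_bordered n k ->
    exists (t : nat) (m : memory),
      [/\ t <= c * (n ^ 4 * k * trunc_log 2 k),
          run p t 0 (init_mem r n k) = Some m,
          space_ok p t (c * n) 0 (init_mem r n k) &
          exists w : n.-tuple 'I_k,
            [/\ bordered (wordval w), bordered_rank w = r &
                forall i, i < n -> m i = nth 0 (wordval w) i]].
Proof.
exists unrank_program, 400 => n k r n_gt0 k_gt1 rB.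
have [|u [m [s [ut rm sw [bs rE] ms]]]] := @unrank_program_correct n k r n_gt0 _ rB.
  by lia.
have [w ws] := words_wordval sw; exists u, m; split.
(* As [k >= 2], the logarithm is at least 1 and multiplying by it only weakens the bound. *)
- have log_gt0 : 0 < trunc_log 2 k by apply: trunc_log_max.
  apply: (leq_trans ut); rewrite leq_mul //.
  by rewrite leq_pmulr.
(* Past the end of the program, [cur] returns the default [IHalt]. *)
- by apply: reach_run rm _; rewrite /halted /cur nth_default.
- exact: reach_space_ok rm.
exists w; rewrite ws; split=> //.
by rewrite bordered_rank_below ws // -rE.
Qed.
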